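(* The problem $(\mathrm{DIT}_{H\infty}^1)$, i.e. the problem $$\max_{\tilde w}\ \tilde w(T)=\sum_{t_k\in Y}\tilde w(P_k)$$ subject to $$\min_{t_k\in Y}\tilde w(P_k)\ge M,\quad \max_{e\in E}c(e)(\tilde w(e)-w(e))\le K,\quad \sum_{e\in E}H(\tilde w(e),w(e))\le 1,\quad w(e)\le\tilde w(e)\le u(e)\ (e\in E),$$ can be solved (an optimal solution found, or infeasibility reported) by an algorithm running in $O(n)$ time.
   Context: $T=(V,E)$ is a tree rooted at $s$ with $V=\{s,v_1,\dots,v_n\}$ and $E=\{e_1,\dots,e_n\}$; $Y=\{t_1,\dots,t_m\}$ is the set of leaf nodes. Each edge $e\in E$ has an original weight $w(e)$ and an upper bound $u(e)$ with $u(e)\ge w(e)\ge 0$, and a unit cost $c(e)>0$. $K$ and $M$ are given values. $P_k$ is the path from $s$ to the leaf $t_k$. For an edge weight vector $w'$, $w'(P_k)=\sum_{e\in P_k}w'(e)$ and $w'(T)=\sum_{t_k\in Y}w'(P_k)$. $H(a,b)=0$ if $a=b$ and $H(a,b)=1$ if $a\ne b$. (The general problem has a constraint $\sum_{e}r(e)H(\tilde w(e),w(e))\le N$ with positive integers $r(e)$; here $N=1$ and $r(e)=1$ for all $e$.) *)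

(* Defs.v *)
From HB Require Import structures.
From mathcomp Require Import all_boot all_order all_algebra.

Set Implicit Arguments.
Unset Strict Implicit.
Unset Printing Implicit Defensive.

Import Order.TTheory GRing.Theory Num.Theory.
Local Open Scope ring_scope.

(* Rooted trees.  The nodes are s = 0 and v_1, ..., v_n; the edge indexed by
   e : 'I_n is the one joining the node [head e] = v_(e+1) to its parent.  The
   numbering of the nodes is arbitrary: a parent may be numbered after its
   children. *)

Definition node (n : nat) := 'I_n.+1.

Definition head n (e : 'I_n) : node n := lift ord0 e.

(* One step towards the root; the root is sent to itself. *)
Definition up n (par : 'I_n -> node n) (v : node n) : node n :=
  if unlift ord0 v is Some e then par e else ord0.

Record rtree (n : nat) := RTree {
  parent : 'I_n -> node n;
  rooted : forall v : node n, fconnect (up parent) v ord0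
}.

(* For n > 0 the root has a child, hence is not a leaf. *)
Definition leaves n (T : rtree n) : {set node n} :=
  [set v | [forall e, parent T e != v]].

(* An edge is on the path from s to v iff its lower endpoint is v or an
   ancestor of v. *)
Definition root_path n (T : rtree n) (v : node n) : {set 'I_n} :=
  [set e | fconnect (up (parent T)) v (head e)].

Section Problem.
Variable R : realFieldType.

(* Minimum and maximum of f over a finite set A; 0 is a junk value for A = set0,
   which does not occur below when n > 0. *)
Definition min_over (I : finType) (A : {set I}) (f : I -> R) : R :=
  if [pick i in A] is Some i0 then f [arg min_(i < i0 in A) f i]%O else 0.

Definition max_over (I : finType) (A : {set I}) (f : I -> R) : R :=
  if [pick i in A] is Some i0 then f [arg max_(i > i0 in A) f i]%O else 0.

Lemma min_over_ge (I : finType) (A : {set I}) (f : I -> R) (M : R) :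
  A != set0 ->
  reflect (forall i, i \in A -> M <= f i) (M <= min_over A f).
Proof.
rewrite /min_over => A0; case: pickP => [i0 Ai0|noA]; last first.
  by case/negP: A0; apply/eqP/setP => i; rewrite noA inE.
case: arg_minP => // i Ai imin; apply: (iffP idP) => [Mi j Aj|]; last exact.
exact: le_trans Mi (imin j Aj).
Qed.

Lemma max_over_le (I : finType) (A : {set I}) (f : I -> R) (K : R) :
  A != set0 ->
  reflect (forall i, i \in A -> f i <= K) (max_over A f <= K).
Proof.
rewrite /max_over => A0; case: pickP => [i0 Ai0|noA]; last first.
  by case/negP: A0; apply/eqP/setP => i; rewrite noA inE.
case: arg_maxP => // i Ai imax; apply: (iffP idP) => [Ki j Aj|]; last exact.
exact: le_trans (imax j Aj) Ki.
Qed.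

Variables (n : nat) (T : rtree n).
Implicit Types w : 'I_n -> R.

Definition path_weight w (v : node n) : R := \sum_(e in root_path T v) w e.

Definition tree_weight w : R := \sum_(t in leaves T) path_weight w t.

Definition hamming (a b : R) : nat := a != b.

Definition feasible (w u c : 'I_n -> R) (K M : R) (w' : 'I_n -> R) : Prop :=
  [/\ M <= min_over (leaves T) (path_weight w'),
      max_over [set: 'I_n] (fun e => c e * (w' e - w e)) <= K,
      (\sum_(e : 'I_n) hamming (w' e) (w e) <= 1)%N
    & forall e, w e <= w' e <= u e].

Definition optimal (w u c : 'I_n -> R) (K M : R) (w' : 'I_n -> R) : Prop :=
  feasible w u c K M w' /\
  forall w'', feasible w u c K M w'' -> tree_weight w'' <= tree_weight w'.

End Problem.

(* Algorithms are programs of a real RAM: a unit-cost machine with index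
   (natural number) and real registers and arrays.  Real data only undergo field
   operations and comparisons.  Indices only undergo constants, successor,
   predecessor and comparison, so that in time t no index exceeds the input
   indices and program constants by more than t; real numbers are never
   converted to indices.  Programs are independent of the size and of the field
   of scalars. *)

Inductive nexp :=
  | NConst of nat
  | NReg of nat
  | NGet of nat & nexp
  | NSucc of nexp
  | NPred of nexp.

Inductive rexp :=
  | RZero
  | ROne
  | RReg of nat
  | RGet of nat & nexp
  | RAdd of rexp & rexp
  | RSub of rexp & rexp
  | RMul of rexp & rexp
  | RDiv of rexp & rexp.

Inductive bexp :=
  | BNEq of nexp & nexp
  | BNLt of nexp & nexp
  | BREq of rexp & rexp
  | BRLt of rexp & rexp
  | BNot of bexp
  | BAnd of bexp & bexp.

Inductive cmd :=
  | Skip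
  | NSet of nat & nexp
  | NPut of nat & nexp & nexp
  | RSet of nat & rexp
  | RPut of nat & nexp & rexp
  | Seq of cmd & cmd
  | If of bexp & cmd & cmd
  | While of bexp & cmd.

Fixpoint ncost (e : nexp) : nat :=
  match e with
  | NConst _ | NReg _ => 1
  | NGet _ e | NSucc e | NPred e => (ncost e).+1
  end.

Fixpoint rcost (e : rexp) : nat :=
  match e with
  | RZero | ROne | RReg _ => 1
  | RGet _ e => (ncost e).+1
  | RAdd e1 e2 | RSub e1 e2 | RMul e1 e2 | RDiv e1 e2 =>
      (rcost e1 + rcost e2).+1
  end.

Fixpoint bcost (b : bexp) : nat :=
  match b with
  | BNEq e1 e2 | BNLt e1 e2 => (ncost e1 + ncost e2).+1
  | BREq e1 e2 | BRLt e1 e2 => (rcost e1 + rcost e2).+1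
  | BNot b => (bcost b).+1
  | BAnd b1 b2 => (bcost b1 + bcost b2).+1
  end.

Definition upd (A : Type) (f : nat -> A) (k : nat) (a : A) : nat -> A :=
  fun j => if j == k then a else f j.

Section Semantics.
Variable R : realFieldType.

Record state := State {
  nreg : nat -> nat;
  rreg : nat -> R;
  narr : nat -> nat -> nat;
  rarr : nat -> nat -> R
}.

Implicit Types s : state.

Definition set_nreg s x a :=
  State (upd (nreg s) x a) (rreg s) (narr s) (rarr s).
Definition set_rreg s x a :=
  State (nreg s) (upd (rreg s) x a) (narr s) (rarr s).
Definition set_narr s x i a :=
  State (nreg s) (rreg s) (upd (narr s) x (upd (narr s x) i a)) (rarr s).
Definition set_rarr s x i a :=
  State (nreg s) (rreg s) (narr s) (upd (rarr s) x (upd (rarr s x) i a)).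

Fixpoint neval s (e : nexp) : nat :=
  match e with
  | NConst k => k
  | NReg x => nreg s x
  | NGet a e => narr s a (neval s e)
  | NSucc e => (neval s e).+1
  | NPred e => (neval s e).-1
  end.

Fixpoint reval s (e : rexp) : R :=
  match e with
  | RZero => 0
  | ROne => 1
  | RReg x => rreg s x
  | RGet a e => rarr s a (neval s e)
  | RAdd e1 e2 => reval s e1 + reval s e2
  | RSub e1 e2 => reval s e1 - reval s e2
  | RMul e1 e2 => reval s e1 * reval s e2
  | RDiv e1 e2 => reval s e1 / reval s e2
  end.

Fixpoint beval s (b : bexp) : bool :=
  match b with
  | BNEq e1 e2 => neval s e1 == neval s e2
  | BNLt e1 e2 => (neval s e1 < neval s e2)%N
  | BREq e1 e2 => reval s e1 == reval s e2
  | BRLt e1 e2 => reval s e1 < reval s e2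
  | BNot b => ~~ beval s b
  | BAnd b1 b2 => beval s b1 && beval s b2
  end.

(* [exec p s t s']: started in s, the program p halts in s' after t steps. *)
Inductive exec : cmd -> state -> nat -> state -> Prop :=
  | ExecSkip s : exec Skip s 1 s
  | ExecNSet s x e :
      exec (NSet x e) s (ncost e).+1 (set_nreg s x (neval s e))
  | ExecNPut s a i e :
      exec (NPut a i e) s (ncost i + ncost e).+1
        (set_narr s a (neval s i) (neval s e))
  | ExecRSet s x e :
      exec (RSet x e) s (rcost e).+1 (set_rreg s x (reval s e))
  | ExecRPut s a i e :
      exec (RPut a i e) s (ncost i + rcost e).+1
        (set_rarr s a (neval s i) (reval s e))
  | ExecSeq p1 p2 s s1 s2 t1 t2 :
      exec p1 s t1 s1 -> exec p2 s1 t2 s2 ->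
      exec (Seq p1 p2) s (t1 + t2) s2
  | ExecIf b p1 p2 s s' t :
      exec (if beval s b then p1 else p2) s t s' ->
      exec (If b p1 p2) s (bcost b + t).+1 s'
  | ExecWhileF b p s :
      ~~ beval s b -> exec (While b p) s (bcost b).+1 s
  | ExecWhileT b p s s1 s2 t1 t2 :
      beval s b -> exec p s t1 s1 -> exec (While b p) s1 t2 s2 ->
      exec (While b p) s (bcost b + t1 + t2).+1 s2.

Lemma exec_det p s t1 s1 t2 s2 :
  exec p s t1 s1 -> exec p s t2 s2 -> t1 = t2 /\ s1 = s2.
Proof.
move=> E1; elim: E1 t2 s2 => {p s t1 s1}; try by move=> *; match goal with
  | E : exec _ _ _ _ |- _ => inversion E end.
- move=> p1 p2 s s1 s2 t1 t2 _ IH1 _ IH2 t s' E.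
  inversion E as [| | | | | ? ? ? ? ? ? ? F1 F2 | | |]; subst.
  by case: (IH1 _ _ F1) => ? ?; subst; case: (IH2 _ _ F2) => -> ->.
- move=> b p1 p2 s s1 t1 _ IH t s' E.
  inversion E as [| | | | | | ? ? ? ? ? ? F | |]; subst.
  by case: (IH _ _ F) => -> ->.
- move=> b p s bF t s' E.
  inversion E as [| | | | | | | | ? ? ? ? ? ? ? bT]; subst => //.
  by rewrite bT in bF.
- move=> b p s s1 s2 t1 t2 bT _ IH1 _ IH2 t s' E.
  inversion E as [| | | | | | | ? ? ? bF | ? ? ? ? ? ? ? ? F1 F2]; subst.
    by rewrite bT in bF.
  by case: (IH1 _ _ F1) => ? ?; subst; case: (IH2 _ _ F2) => -> ->.
Qed.

(* Input: index register 0 holds n, real registers 0 and 1 hold K and M; index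
   array 0 lists the parents of the nodes and real arrays 0, 1, 2 list w, u, c,
   the entry of the edge e : 'I_n being at position e.+1.  All the rest of the
   memory is 0. *)
Definition tabulate (A : Type) n (x0 : A) (f : 'I_n -> A) (k : nat) : A :=
  if k is k'.+1 then oapp f x0 (insub k') else x0.

Definition input n (T : rtree n) (w u c : 'I_n -> R) (K M : R) : state :=
  State
    (upd (fun=> 0%N) 0 n)
    (upd (upd (fun=> 0) 0 K) 1 M)
    (fun a => if a is 0%N then tabulate 0%N (fun e => val (parent T e))
              else fun=> 0%N)
    (fun a => match a with
              | 0%N => tabulate 0 w
              | 1%N => tabulate 0 u
              | 2%N => tabulate 0 c
              | _ => fun=> 0
              end).

(* Output: index register 1 holds 1 if a solution is returned and 0 if the
   problem is reported to be infeasible; the solution is in real array 3, the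
   entry of the edge e being at position e.+1. *)
Definition status s : nat := nreg s 1.

Definition solution n s (e : 'I_n) : R := rarr s 3 e.+1.

Definition correct_output n (T : rtree n) (w u c : 'I_n -> R) (K M : R) s :=
  (status s = 1%N /\ optimal T w u c K M (solution s)) \/
  (status s = 0%N /\ forall w', ~ feasible T w u c K M w').

End Semantics.

(* Main.v *)
Require Import Defs.
From HB Require Import structures.
From mathcomp Require Import all_boot all_order all_algebra.
From mathcomp Require Import zify lra.

Set Implicit Arguments.
Unset Strict Implicit.
Unset Printing Implicit Defensive.

Import Order.TTheory GRing.Theory Num.Theory.
Local Open Scope ring_scope.

(* Raising the single edge e by d adds d to the weight of every path through
   e, hence L(e) d to the objective, where L(e) is the number of leaves below
   e.  So e should be raised by delta(e) = min(u(e) - w(e), K / c(e)).  This is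
   feasible iff e lies on all the paths of weight less than M and the smallest
   path weight D satisfies D + delta(e) >= M; among these edges, one with the
   largest L(e) delta(e) is optimal.
   As the nodes are numbered arbitrarily, the tree is first peeled from its
   leaves: a node enters the queue once all its children have been processed.
   Path weights are then computed backwards along the queue; the numbers of
   leaves, and of leaves with path weight less than M, below each node are
   summed forwards. *)

Local Notation head := Defs.head.

(** * Programs with loops of n rounds *)

Section Hoare.
Variable R : realFieldType.
Implicit Types s : state R.

Fixpoint straight (p : cmd) : bool :=
  match p with
  | Seq p1 p2 | If _ p1 p2 => straight p1 && straight p2
  | While _ _ => false
  | _ => true
  end.

(* The junk value on loops is irrelevant: [run] is only used on straight-line
   programs. *)
Fixpoint run (p : cmd) s : state R :=
  match p with
  | Skip | While _ _ => s
  | NSet x e => set_nreg s x (neval s e)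
  | NPut a i e => set_narr s a (neval s i) (neval s e)
  | RSet x e => set_rreg s x (reval s e)
  | RPut a i e => set_rarr s a (neval s i) (reval s e)
  | Seq p1 p2 => run p2 (run p1 s)
  | If b p1 p2 => if beval s b then run p1 s else run p2 s
  end.

(* For a loop, the cost of a single round. *)
Fixpoint cost (p : cmd) : nat :=
  match p with
  | Skip => 1
  | NSet _ e => (ncost e).+1
  | NPut _ i e => (ncost i + ncost e).+1
  | RSet _ e => (rcost e).+1
  | RPut _ i e => (ncost i + rcost e).+1
  | Seq p1 p2 => cost p1 + cost p2
  | If b p1 p2 => (bcost b + cost p1 + cost p2).+1
  | While b p => (bcost b + cost p).+1
  end.

Lemma exec_run p s :
  straight p -> exists2 t, (t <= cost p)%N & exec p s t (run p s).
Proof.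
elim: p s => //=.
- by move=> s _; exists 1%N => //; constructor.
- by move=> x e s _; exists (ncost e).+1 => //; constructor.
- by move=> a i e s _; exists (ncost i + ncost e).+1 => //; constructor.
- by move=> x e s _; exists (rcost e).+1 => //; constructor.
- by move=> a i e s _; exists (ncost i + rcost e).+1 => //; constructor.
- move=> p1 IH1 p2 IH2 s /andP[/(IH1 s)[t1 le1 E1]].
  move=> /(IH2 (run p1 s))[t2 le2 E2].
  by exists (t1 + t2)%N; [exact: leq_add | exact: ExecSeq E1 E2].
- move=> b p1 IH1 p2 IH2 s /andP[/(IH1 s)[t1 le1 E1]] /(IH2 s)[t2 le2 E2].
  exists (bcost b + if beval s b then t1 else t2).+1; first by case: ifP; lia.
  by apply: ExecIf; case: ifP.
Qed.

Variable n : nat.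

(** Total correctness with a linear time bound. The factor [n.+1] instead of [n] pays for the final
    failing test of a loop. *)
Definition hoare (P : state R -> Prop) (p : cmd) (Q : state R -> Prop) :=
  forall s, P s ->
    exists t s', [/\ exec p s t s', (t <= cost p * n.+1)%N & Q s'].

Lemma hoare_straight (P : state R -> Prop) p (Q : state R -> Prop) :
  straight p -> (forall s, P s -> Q (run p s)) -> hoare P p Q.
Proof.
move=> sp PQ s /PQ Qs; have [t le_t E] := exec_run s sp.
by exists t, (run p s); split=> //; apply: leq_trans le_t _; rewrite leq_pmulr.
Qed.

Lemma hoare_seq (P Q S : state R -> Prop) p1 p2 :
  hoare P p1 Q -> hoare Q p2 S -> hoare P (Seq p1 p2) S.
Proof.
move=> H1 H2 s /H1[t1 [s1 [E1 le1]]] /H2[t2 [s2 [E2 le2 Ss]]].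
exists (t1 + t2)%N, s2; split=> //; first exact: ExecSeq E1 E2.
by rewrite mulnDl leq_add.
Qed.

(** The index of the invariant is the number of finished rounds, so there are exactly [n] of them.
    As the body has no loop, each round takes at most [cost p] steps besides its test. *)
Lemma hoare_while (I : nat -> state R -> Prop) b p :
  straight p ->
  (forall j s, (j < n)%N -> I j s -> beval s b /\ I j.+1 (run p s)) ->
  (forall s, I n s -> ~~ beval s b) ->
  hoare (I 0%N) (While b p) (I n).
Proof.
move=> sp step stop.
suff rounds k j s : (j + k)%N = n -> I j s -> exists t s',
    [/\ exec (While b p) s t s', (t <= cost (While b p) * k.+1)%N & I n s'].
  by move=> s; apply: rounds.
elim: k j s => [|k IH] j s; rewrite ?addn0 => dn Ij.
  exists (bcost b).+1, s; rewrite -dn; split=> //=; last by lia.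
  by apply: ExecWhileF; apply: stop; rewrite -dn.
have [bs Ij1] := step j s ltac:(lia) Ij.
have [t1 le1 E1] := exec_run s sp.
have [t2 [s2 [E2 le2 In]]] := IH j.+1 _ ltac:(lia) Ij1.
exists (bcost b + t1 + t2).+1, s2; split=> //; first exact: ExecWhileT E1 E2.
by rewrite [(_ * k.+2)%N]mulnS /=; move: le2 => /=; lia.
Qed.

(** The counter is increased before the body, so [p] sees 1, ..., [n]: the positions of the edges in
    the arrays, which are also the numbers of their lower endpoints. *)
Definition upto p :=
  Seq (NSet 2 (NConst 0))
    (While (BNLt (NReg 2) (NReg 0)) (Seq (NSet 2 (NSucc (NReg 2))) p)).

Lemma hoare_upto (P : state R -> Prop) (I : nat -> state R -> Prop) p :
  straight p ->
  (forall j s, I j s -> nreg s 2 = j /\ nreg s 0 = n) ->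
  (forall s, P s -> I 0%N (set_nreg s 2 0)) ->
  (forall j s, (j < n)%N -> I j s -> I j.+1 (run p (set_nreg s 2 j.+1))) ->
  hoare P (upto p) (I n).
Proof.
move=> sp Ij PI step; apply: (@hoare_seq _ (I 0%N)).
  exact: hoare_straight.
apply: hoare_while => // [j s lt_j Is | s /Ij /= [-> ->]]; last by rewrite ltnn.
have [j_s n_s] := Ij _ _ Is.
by rewrite /= j_s n_s; split=> //; apply: step.
Qed.

End Hoare.

(** * Paths and leaf counts *)

Section Tree.
Variables (n : nat) (T : rtree n).
Local Notation par := (parent T).
Implicit Types (e : 'I_n) (v t : node n) (A : {set node n}).

Lemma up_head e : up par (head e) = par e.
Proof. by rewrite /up /head liftK. Qed.

Lemma up_root : up par ord0 = ord0.
Proof. by rewrite /up unlift_none. Qed.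

Lemma nodeP v : v = ord0 \/ exists e, v = head e.
Proof. by case: (unliftP ord0 v) => [e ->|->]; [right; exists e | left]. Qed.

Lemma head_inj : injective (@head n).
Proof. exact: lift_inj. Qed.

(** Induction on the number of steps from [v] to the root. *)
Lemma tree_ind (P : node n -> Prop) :
  P ord0 -> (forall e, P (par e) -> P (head e)) -> forall v, P v.
Proof.
move=> P0 Ph v; have /iter_findex := rooted T v; move: (findex _ _ _) => k.
elim: k v => [|k IH] v; first by move=> /= ->.
case: (nodeP v) => [-> //|[e ->]]; rewrite iterSr up_head => kE.
exact/Ph/IH.
Qed.

Lemma root_below v : fconnect (up par) ord0 v = (v == ord0).
Proof.
apply/idP/eqP => [|-> //]; move/iter_findex <-.
by apply: (iter_fix _ up_root).
Qed.

Lemma parent_not_below e : ~~ fconnect (up par) (par e) (head e).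
Proof.
apply/negP => /iter_findex; rewrite -up_head -iterSr.
move: (findex _ _ _) => m cyc.
have {}cyc k : iter (k * m.+1) (up par) (head e) = head e.
  by elim: k => // k IH; rewrite mulSn iterD IH.
have /iter_findex := rooted T (head e); move: (findex _ _ _) => k dk.
(* On a cycle, [k * m.+1] steps lead back to [head e]; being at least [k] steps, they also end at
   the root, which is fixed. *)
have := cyc k; rewrite -(subnK (leq_pmulr k (ltn0Sn m))) iterD dk.
by rewrite (iter_fix _ up_root).
Qed.

Lemma head_below e v :
  fconnect (up par) (head e) v = (v == head e) || fconnect (up par) (par e) v.
Proof.
apply/idP/orP => [/iter_findex|[/eqP -> //|]]; last first.
  by apply: connect_trans; rewrite -up_head fconnect1.
case: (findex _ _ _) => [|k]; first by move=> /= ->; left.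
by rewrite iterSr up_head => <-; right; apply: fconnect_iter.
Qed.

Lemma root_path0 : root_path T ord0 = set0.
Proof. by apply/setP => e; rewrite !inE root_below. Qed.

Lemma root_path_head e : root_path T (head e) = e |: root_path T (par e).
Proof.
by apply/setP => x; rewrite !inE head_below (inj_eq head_inj).
Qed.

Lemma notin_root_path_parent e : e \notin root_path T (par e).
Proof. by rewrite inE parent_not_below. Qed.

Lemma path_weight0 (R : realFieldType) (w : 'I_n -> R) :
  path_weight T w ord0 = 0.
Proof. by rewrite /path_weight root_path0 big_set0. Qed.

Lemma path_weight_head (R : realFieldType) (w : 'I_n -> R) e :
  path_weight T w (head e) = path_weight T w (par e) + w e.
Proof.
rewrite /path_weight root_path_head big_setU1 ?notin_root_path_parent //.
exact: addrC.
Qed.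

(** The subtrees of distinct children are disjoint, so at most one summand is 1. The numerical form
    can be summed over [t]; the induction moves [t] down by one edge. *)
Lemma below_children v t :
  fconnect (up par) t v =
    ((v == t) + \sum_(e | par e == v) fconnect (up par) t (head e))%N :> nat.
Proof.
have split_head e v' : fconnect (up par) (head e) v' =
    ((v' == head e) + fconnect (up par) (par e) v')%N :> nat.
  rewrite head_below; case: eqP => [->|] //.
  by rewrite (negPf (parent_not_below e)).
elim/tree_ind: t v => [|e IH] v.
  rewrite root_below big1 ?addn0 // => e _.
  by rewrite root_below.
rewrite split_head IH; congr addn.
under [RHS]eq_bigr do rewrite split_head (inj_eq head_inj).
rewrite big_split /=; congr addn.
rewrite big_mkcond (bigD1 e) //= eqxx big1 => [|i /negPf ->]; last first.
  by case: (_ == v).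
by rewrite addn0 eq_sym; case: eqP.
Qed.

Definition count_below (A : {set node n}) v : nat :=
  #|[set t in A | fconnect (up par) t v]|.

Lemma count_belowE A v :
  count_below A v = (\sum_(t in A) fconnect (up par) t v)%N.
Proof.
rewrite /count_below -sum1_card.
rewrite (eq_bigl (fun t => (t \in A) && fconnect (up par) t v)).
  by rewrite big_mkcondr; apply: eq_bigr => t _; case: (fconnect _ _ _).
by move=> t; rewrite !inE.
Qed.

(** Double counting from [below_children]. This is the recursion that [sum_up] evaluates. *)
Lemma count_below_children A v :
  count_below A v =
    ((v \in A) + \sum_(e | par e == v) count_below A (head e))%N.
Proof.
rewrite count_belowE; under eq_bigr do rewrite below_children.
rewrite big_split /= exchange_big /=; congr addn.
  rewrite big_mkcond (bigD1 v) //= eqxx big1 => [|t]; first by case: (v \in A).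
  by rewrite eq_sym => /negPf ->; case: ifP.
by apply: eq_bigr => e _; rewrite count_belowE.
Qed.

Lemma count_below_root A : count_below A ord0 = #|A|.
Proof. by apply: eq_card => t; rewrite inE rooted andbT. Qed.

(** A subset of full cardinality is the whole set. This turns a condition on all nodes of [A] into
    an equality of two counts, which the program can test. *)
Lemma count_below_all A v :
  reflect (forall t, t \in A -> fconnect (up par) t v)
    (count_below A v == count_below A ord0).
Proof.
rewrite count_below_root /count_below.
have sub : [set t in A | fconnect (up par) t v] \subset A.
  by apply/subsetP => t; rewrite inE => /andP[].
have -> : #|[set t in A | fconnect (up par) t v]| == #|A| =
          ([set t in A | fconnect (up par) t v] == A).
  by rewrite eqEcard sub /= eqn_leq subset_leq_card.
apply: (iffP eqP) => [/setP AE t At|Ab]; first by have:= AE t; rewrite inE At.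
by apply/setP => t; rewrite inE; case: (boolP (t \in A)) => //= /Ab.
Qed.

(** Take an edge of [X] with the longest root path: that of a child edge is longer by one. *)
Lemma exists_lowest (X : {set 'I_n}) e0 :
  e0 \in X -> exists2 e, e \in X & forall e', e' \in X -> par e' != head e.
Proof.
move=> X0.
have [e Xe deepest] := arg_maxnP (fun e => #|root_path T (head e)|) X0.
exists e => // e' Xe'; apply/eqP => pe'.
have /= := deepest e' Xe'; apply/negP.
rewrite -ltnNge (root_path_head e') cardsU1.
by rewrite notin_root_path_parent pe'.
Qed.

Definition degree v : nat := #|[set e | par e == v]|.

Lemma leaf_degree v : (v \in leaves T) = (degree v == 0%N).
Proof.
rewrite inE cards_eq0; apply/forallP/eqP => [leaf_v|/setP no_child e].
  by apply/setP => e; rewrite !inE (negPf (leaf_v e)).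
by have := no_child e; rewrite !inE => ->.
Qed.

Hypothesis n_gt0 : (0 < n)%N.

Lemma root_not_leaf : ord0 \notin leaves T.
Proof.
suff [e /eqP pe]: exists e, par e == ord0.
  by rewrite inE; apply/negP => /forallP/(_ e); rewrite pe eqxx.
(* The alternative of being the root itself is added to let the induction along the tree go
   through. *)
suff: head (Ordinal n_gt0) = ord0 \/ exists e, par e == ord0 by case.
elim/tree_ind: (head _) => [|e [pe|]]; [by left | right | by right].
by exists e; rewrite pe.
Qed.

Lemma leaves_neq0 : leaves T != set0.
Proof.
have [e _ low] := exists_lowest (in_setT (Ordinal n_gt0)).
apply/set0Pn; exists (head e); rewrite inE; apply/forallP => e'.
exact: low.
Qed.

End Tree.

(** * Optimal upgrades *)

Section Optimum.
Variables (R : realFieldType) (n : nat) (T : rtree n).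
Variables (w u c : 'I_n -> R) (K M : R).
Hypothesis n_gt0 : (0 < n)%N.
Hypothesis w_le_u : forall e, w e <= u e.
Hypothesis c_gt0 : forall e, 0 < c e.
Implicit Types (e : 'I_n) (t : node n).

(** By the Hamming constraint every feasible vector has this form, [d = 0] standing for no
    change. *)
Definition raise e (d : R) : 'I_n -> R := fun x => w x + d *+ (x == e).

Lemma path_weight_raise w' e d t : w' =1 raise e d ->
  path_weight T w' t = path_weight T w t + d *+ (e \in root_path T t).
Proof.
move=> w'E; rewrite /path_weight.
rewrite (eq_bigr (raise e d)) => [|x _]; last exact: w'E.
rewrite big_split /=; congr (_ + _); case: (boolP (e \in _)) => [te|Nte].
  by rewrite (bigD1 e) //= eqxx big1 ?addr0 // => x /andP[_ /negPf ->].
by rewrite big1 // => x tx; case: eqP => // xe; rewrite -xe tx in Nte.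
Qed.

Lemma tree_weight_raise w' e d : w' =1 raise e d ->
  tree_weight T w' =
    tree_weight T w + (count_below T (leaves T) (head e))%:R * d.
Proof.
move=> w'E; rewrite /tree_weight.
rewrite (eq_bigr _ (fun t _ => path_weight_raise t w'E)) big_split /=.
rewrite count_belowE natr_sum mulr_suml; congr (_ + _); apply: eq_bigr => t _.
by rewrite inE mulr_natl.
Qed.

Definition max_raise e : R := Num.min (u e - w e) (K / c e).

Definition bad_leaves : {set node n} :=
  [set t in leaves T | path_weight T w t < M].

(* Capping the least path weight at [M] makes [candidate] uniform: without bad
   leaves it only asks for [max_raise e >= 0], which fails when [K < 0]. *)
Definition least_weight (D : R) : Prop :=
  [/\ D <= M, forall t, t \in leaves T -> D <= path_weight T w t
    & D = M \/ exists2 t, t \in leaves T & D = path_weight T w t].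

Definition candidate D e : bool :=
  (count_below T bad_leaves (head e) == count_below T bad_leaves ord0)
    && (M <= D + max_raise e).

Lemma candidate_feasible D e w' : least_weight D -> candidate D e ->
  w' =1 raise e (max_raise e) -> feasible T w u c K M w'.
Proof.
case=> le_DM le_D _ /andP[/count_below_all bad_e ge_M] w'E.
have d_ge0 : 0 <= max_raise e by move: (max_raise e) ge_M => d; lra.
have d_le_u : max_raise e <= u e - w e by rewrite ge_min lexx.
have d_le_K : max_raise e <= K / c e by rewrite ge_min lexx orbT.
(* The cost constraint at the unchanged edges reads [0 <= K]. *)
have K_ge0 : 0 <= K.
  by have := le_trans d_ge0 d_le_K; rewrite pmulr_lge0 // invr_gt0.
split=> [|||x].
- apply/min_over_ge => [|t leaf_t]; first exact: leaves_neq0.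
  rewrite (path_weight_raise _ w'E).
  have [le_Mt|lt_tM] := leP M (path_weight T w t).
    by rewrite (le_trans le_Mt) // lerDl mulrn_wge0.
  have bad_t : t \in bad_leaves by rewrite inE leaf_t.
  by rewrite inE (bad_e _ bad_t) (le_trans ge_M) // lerD2r le_D.
- apply/max_over_le => [|x _].
    by apply/set0Pn; exists e; rewrite inE.
  rewrite w'E /raise addrC addKr; case: eqP => [->|_]; last by rewrite mulr0.
  by rewrite mulrC -ler_pdivlMr.
- rewrite (bigD1 e) //= big1 ?addn0 => [|x /negPf ne]; first exact: leq_b1.
  by rewrite /hamming w'E /raise ne addr0 eqxx.
rewrite w'E /raise; case: eqP => [->|_]; last by rewrite addr0 lexx w_le_u.
by rewrite lerDl d_ge0 addrC -lerBrDr.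
Qed.

(** The changed edge must lie on the path of every bad leaf, since the other paths keep their
    weights; the path attaining [D] then forces the second condition of [candidate]. *)
Lemma feasible_raise D w' : least_weight D -> feasible T w u c K M w' ->
  exists e d, [/\ w' =1 raise e d, candidate D e & d <= max_raise e].
Proof.
move=> [le_DM le_D D_eq] [ge_M le_K one w'_bounds].
have [e w'E] : exists e, w' =1 raise e (w' e - w e).
  have [e ch_e|no_ch] := pickP (fun e => w' e != w e).
    exists e => x; rewrite /raise; case: eqP => [->|/eqP ne].
      by rewrite addrC subrK.
    rewrite addr0; apply/eqP; apply: contraTT one => ch_x.
    by rewrite (bigD1 e) //= (bigD1 x) //= /hamming ch_e ch_x.
  (* If no weight changes, any edge serves, with raise 0. *)
  exists (Ordinal n_gt0) => x; rewrite /raise.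
  have w'w y : w' y = w y by apply/eqP/negbFE/no_ch.
  by rewrite !w'w subrr mul0rn addr0.
exists e, (w' e - w e).
have d_ge0 : 0 <= w' e - w e by rewrite subr_ge0; case/andP: (w'_bounds e).
have d_le : w' e - w e <= max_raise e.
  rewrite le_min lerD2r; case/andP: (w'_bounds e) => _ -> /=.
  rewrite ler_pdivlMr // mulrC.
  have edges_neq0 : [set: 'I_n] != set0 by apply/set0Pn; exists e; rewrite inE.
  exact: (elimT (max_over_le _ _ edges_neq0) le_K).
split=> //.
have ge_Mt t : t \in leaves T ->
    M <= path_weight T w t + (w' e - w e) *+ (e \in root_path T t).
  move=> leaf_t; rewrite -(path_weight_raise _ w'E).
  exact: (elimT (min_over_ge _ _ (leaves_neq0 T n_gt0)) ge_M).
have bad_e t : t \in bad_leaves -> e \in root_path T t.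
  rewrite inE => /andP[/ge_Mt + lt_tM]; apply: contraTT => /negPf ->.
  by rewrite addr0 -ltNge.
apply/andP; split.
  by apply/count_below_all => t /bad_e; rewrite inE.
(* At the cap [D = M] only a nonnegative raise is required. *)
case: D_eq => [->|[t /ge_Mt ge_t ->]].
  by rewrite lerDl (le_trans d_ge0).
apply: le_trans ge_t _; rewrite lerD2l; apply: le_trans d_le.
by case: (_ \in _).
Qed.

Definition gain e : R :=
  (count_below T (leaves T) (head e))%:R * max_raise e.

(** A competitor raises some candidate [e'] by at most [max_raise e'], so it adds at most [gain e']
    to the objective. *)
Lemma candidate_optimal D e w' : least_weight D -> candidate D e ->
  (forall e', candidate D e' -> gain e' <= gain e) ->
  w' =1 raise e (max_raise e) -> optimal T w u c K M w'.
Proof.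
move=> leastD cand_e best_e w'E; split.
  exact: (candidate_feasible leastD cand_e w'E).
move=> w'' /(feasible_raise leastD)[e' [d [w''E cand_e' le_d]]].
rewrite (tree_weight_raise w'E) (tree_weight_raise w''E) lerD2l.
by apply: le_trans (best_e e' cand_e'); rewrite ler_wpM2l.
Qed.

End Optimum.

(** * The program and its loop invariants *)

(* Index registers: 0 n, 1 status, 2 loop counter, 3 descending counter,
   4 length of the queue, 5 best edge.  Real registers: 0 K, 1 M, 2 least path
   weight (at most M), 3 best gain, 4 raise of the best edge, 5 raise of the
   current edge.  Index arrays: 0 parents, 1 numbers of children, 2 queue,
   3 numbers of processed children.  Real arrays: 0 w, 1 u, 2 c, 3 solution,
   4 numbers of leaves below, 5 numbers of bad leaves below, 6 path weights. *)

Definition count_children : cmd :=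
  let p := NGet 0 (NReg 2) in
  upto (NPut 1 p (NSucc (NGet 1 p))).

Definition push (v : nexp) : cmd :=
  Seq (NPut 2 (NReg 4) v) (NSet 4 (NSucc (NReg 4))).

Definition push_leaves : cmd :=
  upto (If (BNEq (NGet 1 (NReg 2)) (NConst 0)) (push (NReg 2)) Skip).

(** Queue positions start from 0 but the counter from 1, hence [NPred]. The test [0 < p] keeps the
    root, which carries no edge, out of the queue. *)
Definition peel : cmd :=
  let p := NGet 0 (NGet 2 (NPred (NReg 2))) in
  upto (Seq (NPut 3 p (NSucc (NGet 3 p)))
    (If (BAnd (BNLt (NConst 0) p) (BNEq (NGet 3 p) (NGet 1 p))) (push p) Skip)).

(** Read from its end, the queue lists parents before children. Arrays 4 and 5 receive only the own
    contribution of each leaf here. *)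
Definition descend : cmd :=
  let v := NGet 2 (NReg 3) in
  upto (Seq (NSet 3 (NPred (NReg 3)))
    (Seq (RPut 6 v (RAdd (RGet 6 (NGet 0 v)) (RGet 0 v)))
      (If (BNEq (NGet 1 v) (NConst 0))
        (Seq (RPut 4 v ROne)
          (If (BRLt (RGet 6 v) (RReg 1))
            (Seq (RPut 5 v ROne)
              (If (BRLt (RGet 6 v) (RReg 2)) (RSet 2 (RGet 6 v)) Skip))
            Skip))
        Skip))).

Definition sum_up : cmd :=
  let v := NGet 2 (NPred (NReg 2)) in let p := NGet 0 v in
  upto (Seq (RPut 4 p (RAdd (RGet 4 p) (RGet 4 v)))
            (RPut 5 p (RAdd (RGet 5 p) (RGet 5 v)))).

Definition compute_raise : cmd :=
  let i := NReg 2 in let Kc := RDiv (RReg 0) (RGet 2 i) in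
  Seq (RSet 5 (RSub (RGet 1 i) (RGet 0 i)))
      (If (BRLt Kc (RReg 5)) (RSet 5 Kc) Skip).

Definition keep_best : cmd :=
  let i := NReg 2 in let gain := RMul (RGet 4 i) (RReg 5) in
  If (BAnd (BAnd (BREq (RGet 5 i) (RGet 5 (NConst 0)))
                 (BNot (BRLt (RAdd (RReg 2) (RReg 5)) (RReg 1))))
           (BRLt (RReg 3) gain))
    (Seq (Seq (NSet 1 (NConst 1)) (NSet 5 i))
         (Seq (RSet 3 gain) (RSet 4 (RReg 5))))
    Skip.

Definition select : cmd :=
  upto (Seq (RPut 3 (NReg 2) (RGet 0 (NReg 2))) (Seq compute_raise keep_best)).

Definition sorting : cmd :=
  Seq count_children (Seq (Seq (NSet 4 (NConst 0)) push_leaves) peel).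

(** The least weight starts at the cap [M]. The last write is made even without a candidate; the
    status 0 then declares infeasibility. *)
Definition optimizing : cmd :=
  Seq (Seq (Seq (RSet 2 (RReg 1)) (NSet 3 (NReg 0))) descend)
  (Seq sum_up
  (Seq (Seq (Seq (NSet 1 (NConst 0)) (RSet 3 (RSub RZero ROne))) select)
       (RPut 3 (NReg 5) (RAdd (RGet 3 (NReg 5)) (RReg 4))))).

Lemma tabulate_edge (A : Type) n (x0 : A) (f : 'I_n -> A) (e : 'I_n) :
  tabulate x0 f e.+1 = f e.
Proof. by rewrite /tabulate valK. Qed.

(** Matches the increment of a counter when a loop passes to one further edge; [Q] selects the edges
    with a given parent. *)
Lemma card_add1 (I : finType) (P P' Q : pred I) i :
  ~~ P i -> (forall k, P' k = (k == i) || P k) ->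
  #|[set k | P' k && Q k]| = (Q i + #|[set k | P k && Q k]|)%N.
Proof.
move=> NPi P'E; rewrite (cardsD1 i) inE P'E eqxx; congr addn.
apply: eq_card => k; rewrite !inE P'E; case: eqP => // ->.
by rewrite (negPf NPi).
Qed.

Lemma index_rcons_in (I : eqType) (q : seq I) x y :
  y \in q -> index y (rcons q x) = index y q.
Proof. by move=> qy; rewrite -cats1 index_cat qy. Qed.

Lemma index_rcons_notin (I : eqType) (q : seq I) x :
  x \notin q -> index x (rcons q x) = size q.
Proof. by move=> /negPf Nqx; rewrite -cats1 index_cat Nqx /= eqxx addn0. Qed.

(** Missing elements have index [size q], so for [k <= size q] the test [index y q < k] says that
    [y] is among the first [k] entries; a push leaves these alone. *)
Lemma index_rcons_lt (I : eqType) (q : seq I) x y k :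
  (k <= size q)%N -> (index y (rcons q x) < k)%N = (index y q < k)%N.
Proof.
move=> le_k; have [qy|Nqy] := boolP (y \in q); first by rewrite index_rcons_in.
rewrite -cats1 index_cat (negPf Nqy) ltnNge (leq_trans le_k) ?leq_addr //.
by rewrite memNindex // ltnNge le_k.
Qed.

Section Correctness.
Variables (R : realFieldType) (n : nat) (T : rtree n).
Variables (w u c : 'I_n -> R) (K M : R).
Hypothesis n_gt0 : (0 < n)%N.
Hypothesis wu : forall e, 0 <= w e <= u e.
Hypothesis c_gt0 : forall e, 0 < c e.
Implicit Types (e : 'I_n) (v : node n) (s : state R).

Record has_input j s : Prop := HasInput {
  input_counter : nreg s 2 = j;
  input_n : nreg s 0 = n;
  input_K : rreg s 0 = K;
  input_M : rreg s 1 = M;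
  input_parent : forall e, narr s 0 e.+1 = parent T e;
  input_w : forall e, rarr s 0 e.+1 = w e;
  input_u : forall e, rarr s 1 e.+1 = u e;
  input_c : forall e, rarr s 2 e.+1 = c e
}.

Record blank s : Prop := Blank {
  blank_leaves : forall k, rarr s 4 k = 0;
  blank_bad : forall k, rarr s 5 k = 0;
  blank_weights : forall k, rarr s 6 k = 0
}.

(** * Child counts and the peeling of the tree *)

Definition counting j s : Prop :=
  [/\ has_input j s, blank s, forall k, narr s 3 k = 0%N
    & forall v, narr s 1 v =
      #|[set e : 'I_n | (e < j)%N && (parent T e == v)]|].

Lemma count_children_correct :
  hoare n (eq (input T w u c K M)) count_children (counting n).
Proof.
apply: (@hoare_upto _ _ _ counting) => // [j s [[]] //|_ <-|].
  split=> [|//|//|v]; first by split=> // e; apply: tabulate_edge.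
  by rewrite /= eq_card0 // => e; rewrite !inE.
move=> j s lt_j [inp bl bl3 deg].
have /= par_j := input_parent inp (Ordinal lt_j).
split=> [||//|v]; [by case: inp => *; split | by case: bl => *; split |].
rewrite (@card_add1 _ (fun e : 'I_n => e < j)%N _ _ (Ordinal lt_j)) /=.
- rewrite /upd /= par_j -deg -val_eqE eq_sym.
  by case: eqP => [->|_]; rewrite ?add1n ?add0n.
- by rewrite ltnn.
- by move=> e; rewrite ltnS leq_eqVlt.
Qed.

Definition degrees s : Prop := forall v, narr s 1 v = degree T v.

(** A queued edge stands for its lower endpoint, whose number is [e.+1]. *)
Definition queued (q : seq 'I_n) s : Prop :=
  [/\ uniq q, nreg s 4 = size q
    & {in q, forall e, narr s 2 (index e q) = e.+1}].

Lemma queued_push q s e x : neval s x = e.+1 -> e \notin q -> queued q s ->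
  queued (rcons q e) (run (push x) s).
Proof.
move=> xE Nqe [uq tail qE]; split.
- by rewrite rcons_uniq Nqe.
- by rewrite size_rcons /= /upd /= tail.
move=> y; rewrite mem_rcons inE /= /upd /= tail xE => /predU1P[->|qy].
  by rewrite index_rcons_notin ?eqxx.
rewrite index_rcons_in // qE //; move: qy; rewrite -index_mem => lt_y.
by rewrite (ltn_eqF lt_y).
Qed.

Definition leaves_queued j s : Prop :=
  [/\ has_input j s, blank s, forall k, narr s 3 k = 0%N, degrees s
    & exists2 q, queued q s
        & forall e, (e \in q) = (e < j)%N && (degree T (head e) == 0%N)].

Lemma push_leaves_correct :
  hoare n (counting n) (Seq (NSet 4 (NConst 0)) push_leaves) (leaves_queued n).
Proof.
apply: (@hoare_seq _ _ _ (fun s => counting n s /\ nreg s 4 = 0%N)).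
  apply: hoare_straight => // s [inp bl bl3 deg]; split=> //; split=> //.
    by case: inp => *; split.
  by case: bl => *; split.
apply: (@hoare_upto _ _ _ leaves_queued) => //.
- by move=> j s [[]].
- move=> s [[inp bl bl3 deg] tail]; split=> //; first by case: inp => *; split.
  + by case: bl => *; split.
  + move=> v; rewrite [LHS]deg; apply: eq_card => e.
    by rewrite !inE ltn_ord.
  by exists [::] => //; split.
move=> j s lt_j [inp bl bl3 deg [q qq qE]].
have degj : narr s 1 j.+1 = degree T (head (Ordinal lt_j)) by rewrite -deg.
have jE e : (e < j.+1)%N = (e == Ordinal lt_j) || (e < j)%N.
  by rewrite ltnS leq_eqVlt.
rewrite /= {1}/upd /= degj; case: ifP => leaf_j.
  have := @queued_push q (set_nreg s 2 j.+1) (Ordinal lt_j) (NReg 2) erefl.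
  rewrite qE ltnn => /(_ isT) push_j.
  split=> //; first by case: inp => *; split.
    by case: bl => *; split.
  exists (rcons q (Ordinal lt_j)); first by apply: push_j; case: qq.
  by move=> e; rewrite mem_rcons inE qE jE; case: eqP => // ->.
split=> //; [by case: inp => *; split | by case: bl => *; split |].
exists q; first by case: qq.
by move=> e; rewrite qE jE; case: (e =P _) => // ->; rewrite leaf_j andbF.
Qed.

(** The first [j] entries of the queue are the processed edges. The queue consists of exactly the
    edges whose child edges are all processed, and lists child edges first. *)
Definition peeling j s : Prop :=
  [/\ has_input j s, blank s, degrees s
    & exists q, [/\ queued q s /\ (j <= size q)%N,
      forall v, narr s 3 v =
        #|[set e | (index e q < j)%N && (parent T e == v)]|,
      forall e, e \in q <->
        (forall e', parent T e' = head e -> (index e' q < j)%N)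
    & {in q, forall e e', parent T e' = head e -> (index e' q < index e q)%N}]].

(* A lowest edge missing from the queue would have all its children
   processed. *)
Lemma peeling_progress (q : seq 'I_n) j :
  uniq q -> (j < n)%N -> (j <= size q)%N ->
  (forall e, e \in q <->
    (forall e', parent T e' = head e -> (index e' q < j)%N)) ->
  (j < size q)%N.
Proof.
move=> uq lt_j le_j qE; rewrite ltn_neqAle le_j andbT; apply/eqP => j_size.
have [all_q|] := boolP [forall e, e \in q].
  have: size q = n.
    rewrite -(card_uniqP uq) -[RHS]card_ord; apply: eq_card => e.
    by rewrite (forallP all_q).
  by move: lt_j; rewrite j_size => /[swap] ->; rewrite ltnn.
rewrite negb_forall => /existsP[e0 Ne0].
have X0 : e0 \in [set e | e \notin q] by rewrite inE.
have [e] := exists_lowest T X0; rewrite inE => /negP Ne low; apply: Ne.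
apply/qE => e' pe'; rewrite j_size index_mem.
by apply: contraTT (introT eqP pe') => Ne'; apply: low; rewrite inE.
Qed.

(** Justifies the test of [peel] for a node with all its children processed: equal counts mean equal
    sets. *)
Lemma card_children (P : pred 'I_n) v :
  reflect (forall e, parent T e = v -> P e)
    (#|[set e | P e && (parent T e == v)]| == degree T v).
Proof.
have sub : [set e | P e && (parent T e == v)] \subset
           [set e | parent T e == v].
  by apply/subsetP => e; rewrite !inE => /andP[].
rewrite eqn_leq (subset_leq_card sub) /= -[(_ <= _)%N]/(true && _).
apply: (iffP idP) => [le_card e pe|all_P].
  have /eqP/setP/(_ e) : [set e | P e && (parent T e == v)] ==
                         [set e | parent T e == v] by rewrite eqEcard sub.
  by rewrite !inE pe eqxx andbT.
apply/subset_leq_card/subsetP => e; rewrite !inE => /eqP pe.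
by rewrite pe eqxx all_P.
Qed.

Lemma peel_correct : hoare n (leaves_queued n) peel (peeling n).
Proof.
apply: (@hoare_upto _ _ _ peeling) => //.
- by move=> j s [[]].
- move=> s [inp bl bl3 deg [q qq qE]].
  split=> //; [by case: inp => *; split | by case: bl => *; split |].
  exists q; split=> [|v|e|e + e' /eqP pe']; first by case: qq.
  + by rewrite [LHS]bl3 eq_card0 // => e; rewrite inE.
  + rewrite qE ltn_ord /= cards_eq0; split=> [/eqP/setP no e' /eqP pe'|no].
      by have := no e'; rewrite !inE pe'.
    by apply/eqP/setP => e'; rewrite !inE; apply/eqP => /no.
  rewrite qE ltn_ord /= cards_eq0 => /eqP/setP/(_ e').
  by rewrite !inE pe'.
move=> j s lt_j [inp bl deg [q [[[uq tail qs] le_j] doneE qE order]]].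
have lt_jq := peeling_progress uq lt_j le_j qE.
have [e [qe j_e]] : exists e, e \in q /\ index e q = j.
  have e0 : 'I_n by exists j.
  by exists (nth e0 q j); rewrite mem_nth // index_uniq.
have lt_jS y : (index y q < j.+1)%N = (y == e) || (index y q < j)%N.
  rewrite ltnS leq_eqVlt; congr orb; apply/eqP/eqP => [jy|-> //].
  have qy : y \in q by rewrite -index_mem jy.
  by rewrite -(nth_index e qy) jy -j_e nth_index.
have ej : narr s 2 j = e.+1 by rewrite -j_e qs.
have pj : narr s 0 e.+1 = parent T e := input_parent inp e.
have {}doneE v : upd (narr s 3) (parent T e) (narr s 3 (parent T e)).+1 v =
    #|[set y | (index y q < j.+1)%N && (parent T y == v)]|.
  rewrite (@card_add1 _ (fun y => index y q < j)%N _ _ e) ?j_e ?ltnn //.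
  rewrite /upd -!doneE -val_eqE eq_sym.
  by case: eqP => [->|_]; rewrite ?add1n ?add0n.
set s1 := set_narr (set_nreg s 2 j.+1) 3 (parent T e)
   (narr s 3 (parent T e)).+1.
pose p := NGet 0 (NGet 2 (NPred (NReg 2))).
have ps1 : neval s1 p = parent T e by rewrite /= /upd /= ej.
have runS : run (NPut 3 p (NSucc (NGet 3 p))) (set_nreg s 2 j.+1) = s1.
  by rewrite /= /upd /= ej pj.
(* Unfolding by conversion keeps the intermediate state [s1] folded. *)
rewrite -[run _ _]/(run (If (BAnd (BNLt (NConst 0) p)
  (BNEq (NGet 3 p) (NGet 1 p))) (push p) Skip)
  (run (NPut 3 p (NSucc (NGet 3 p))) (set_nreg s 2 j.+1))) {}runS.
rewrite -[run _ _]/(if (0 < neval s1 p)%N && (narr s1 3 (neval s1 p) ==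
  narr s (1) (neval s1 p)) then run (push p) s1 else s1) ps1.
have {}doneE v : narr s1 3 v =
  #|[set y | (index y q < j.+1)%N && (parent T y == v)]| by rewrite -doneE.
rewrite doneE deg.
have qs1 : queued q s1 by [].
have [inp1 bl1 deg1] : [/\ has_input j.+1 s1, blank s1 & degrees s1].
  by split=> //; [case: inp => *; split | case: bl => *; split].
(* Processing [e] affects the queue condition only for the edge ending at its parent. *)
have other x : parent T e <> head x -> x \in q <->
    forall e', parent T e' = head x -> (index e' q < j.+1)%N.
  move=> pNx; split=> [/qE qx e' /[dup] pe' /qx|qx].
    by rewrite lt_jS => ->; rewrite orbT.
  apply/qE => e' pe'; have := qx e' pe'; rewrite lt_jS => /predU1P[e'e|//].
  by case: pNx; rewrite -e'e.
case: ifP => [/andP[p_gt0 /card_children all_done]|not_done]; last first.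
  split=> //; exists q; split=> // x.
  have [pe|/other //] := (parent T e) =P head x.
  split=> [/qE qx e' /qx|qx]; first by rewrite lt_jS => ->; rewrite orbT.
  by move: not_done; rewrite pe /= => /negP[]; apply/card_children.
have [pe0|[x px]] := nodeP (parent T e); first by rewrite pe0 in p_gt0.
(* The child edge [e] of [x] is only now processed, so [x] has not been pushed before. *)
have Nqx : x \notin q by apply/negP => /qE/(_ e px); rewrite j_e ltnn.
have qq := @queued_push q s1 x p ltac:(by rewrite ps1 px) Nqx qs1.
split; [by case: inp1 => *; split | by case: bl1 => *; split | exact: deg1 |].
exists (rcons q x); split.
- by rewrite size_rcons ltnW.
- move=> v; rewrite [LHS]doneE; apply: eq_card => y.
  by rewrite !inE index_rcons_lt.
- move=> y; rewrite mem_rcons inE.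
  split=> [/predU1P[->|qy] e' pe'|qy].
  + by rewrite index_rcons_lt // all_done ?px.
  + by rewrite index_rcons_lt // lt_jS (proj1 (qE y) qy) ?orbT.
  apply/predU1P; have [|yNx] := y =P x; [by left | right].
  apply/other => [|e' /qy]; last by rewrite index_rcons_lt.
  by rewrite px => /head_inj/esym.
move=> y; rewrite mem_rcons inE => /predU1P[->|qy] e' pe'.
  rewrite index_rcons_notin // index_rcons_lt //.
  by rewrite (leq_trans (all_done _ _)) ?px.
rewrite (index_rcons_in _ qy) index_rcons_lt ?index_size //.
exact: order.
Qed.

(** * Topological numbering of the edges *)

Definition topological (rank : 'I_n -> nat) : Prop :=
  [/\ forall e, (rank e < n)%N, injective rank,
    forall j, (j < n)%N -> exists e, rank e = j
    & forall e e', parent T e' = head e -> (rank e' < rank e)%N].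

(** A queue without repetitions and of length at least [n] contains every edge once; the rank is the
    position in it. *)
Lemma peeling_topological s : peeling n s -> exists2 rank, topological rank &
  [/\ has_input n s, blank s, degrees s
    & forall e, narr s 2 (rank e) = e.+1].
Proof.
case=> inp bl deg [q [[[uq tail qs] le_n] _ _ order]].
have sz : size q = n.
  apply/eqP; rewrite eqn_leq le_n -(card_uniqP uq) -[leqRHS]card_ord.
  by rewrite max_card.
have all_q e : e \in q.
  have [|| _ ->] := @uniq_min_size _ q (enum 'I_n) uq; last by rewrite mem_enum.
    by move=> x _; rewrite mem_enum.
  by rewrite size_enum_ord.
exists (index^~ q); first split=> [e|e e' ee'|j lt_j|e e' pe'].
- by rewrite -[ltnRHS]sz index_mem.
- by rewrite -(nth_index e (all_q e)) ee' nth_index.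
- by exists (nth (Ordinal lt_j) q j); rewrite index_uniq ?sz.
- exact: order.
by split=> // e; apply: qs.
Qed.

Section Ranked.
Variable rank : 'I_n -> nat.
Hypothesis rank_topological : topological rank.

Definition ranked s : Prop := forall e, narr s 2 (rank e) = e.+1.

(** * Path weights, backwards along the queue *)

Local Notation bad := (bad_leaves T w M).
Implicit Types (f : nat -> R) (A : {set node n}).

(** The queue is read from its end, so [j] rounds cover the last [j] ranks. *)
Definition visited j e : bool := (n - j <= rank e)%N.

Definition weights_of j f : Prop :=
  f 0%N = 0 /\ forall e, visited j e -> f e.+1 = path_weight T w (head e).

Definition indicator_of A j f : Prop :=
  f 0%N = 0 /\ forall e, f e.+1 = (visited j e && (head e \in A))%:R.

Definition least_of j (D : R) : Prop :=
  [/\ D <= M,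
    forall e, visited j e -> head e \in leaves T ->
      D <= path_weight T w (head e)
  & D = M \/ exists2 t, t \in leaves T & D = path_weight T w t].

Section Visit.
Variables (j : nat) (e : 'I_n).
Hypotheses (lt_j : (j < n)%N) (rank_e : rank e = (n - j.+1)%N).

Lemma visitedS x : visited j.+1 x = (x == e) || visited j x.
Proof.
have [_ rank_inj _ _] := rank_topological.
by rewrite /visited -(inj_eq rank_inj) rank_e; lia.
Qed.

(** The parent is the root, whose entry stays 0, or the lower endpoint of an edge of larger rank,
    visited earlier. *)
Lemma weights_of_parent f : weights_of j f ->
  f (parent T e) = path_weight T w (parent T e).
Proof.
case=> f0 fE; have [->|[x px]] := nodeP (parent T e).
  by rewrite path_weight0.
have [_ _ _ /(_ _ _ px)] := rank_topological; rewrite rank_e => lt_x.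
by rewrite px; apply: fE; rewrite /visited; lia.
Qed.

Lemma weights_of_visit f : weights_of j f ->
  weights_of j.+1 (upd f e.+1 (path_weight T w (head e))).
Proof.
case=> f0 fE; split=> // x; rewrite visitedS /upd eqSS val_eqE.
by case: eqP => [->|_] //= /fE.
Qed.

Lemma indicator_of_visit A f : head e \in A -> indicator_of A j f ->
  indicator_of A j.+1 (upd f e.+1 1).
Proof.
move=> Ae [f0 fE]; split=> // x; rewrite visitedS /upd eqSS val_eqE.
by case: eqP => [->|_] /=; rewrite ?Ae // fE.
Qed.

Lemma indicator_of_skip A f : head e \notin A -> indicator_of A j f ->
  indicator_of A j.+1 f.
Proof.
move=> NAe [f0 fE]; split=> // x; rewrite visitedS fE.
by case: eqP => [->|_] //=; rewrite (negPf NAe) andbF.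
Qed.

Lemma least_of_visit D : head e \in leaves T ->
  path_weight T w (head e) < D -> least_of j D ->
  least_of j.+1 (path_weight T w (head e)).
Proof.
move=> leaf_e lt_D [le_M le_D _]; split; last by right; exists (head e).
  exact: le_trans (ltW lt_D) le_M.
move=> x; rewrite visitedS => /predU1P[->|vx leaf_x]; first by rewrite lexx.
exact: le_trans (ltW lt_D) (le_D x vx leaf_x).
Qed.

Lemma least_of_skip D :
  (head e \in leaves T -> D <= path_weight T w (head e)) -> least_of j D ->
  least_of j.+1 D.
Proof.
move=> le_e [le_M le_D D_eq]; split=> // x; rewrite visitedS.
by case/predU1P => [->|]; [exact: le_e | exact: le_D].
Qed.

End Visit.

Record descending j s : Prop := Descending {
  descending_input : has_input j s;
  descending_degrees : degrees s;
  descending_ranked : ranked s;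
  descending_counter : nreg s 3 = (n - j)%N;
  descending_weights : weights_of j (rarr s 6);
  descending_leaves : indicator_of (leaves T) j (rarr s 4);
  descending_bad : indicator_of bad j (rarr s 5);
  descending_least : least_of j (rreg s 2)
}.

Lemma descend_correct :
  hoare n (fun s => [/\ has_input n s, blank s, degrees s & ranked s])
    (Seq (Seq (RSet 2 (RReg 1)) (NSet 3 (NReg 0))) descend) (descending n).
Proof.
apply: (@hoare_seq _ _ _ (fun s => descending 0 (set_nreg s 2 0))).
  apply: hoare_straight => // s [inp bl deg rk].
  have unvisited e : visited 0 e = false.
    have [lt_n _ _ _] := rank_topological.
    by rewrite /visited subn0 leqNgt lt_n.
  have blank_indicator A f : (forall k, f k = 0) -> indicator_of A 0 f.
    by move=> f0; split=> // e; rewrite f0 unvisited.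
  split=> //=.
  - by case: inp => *; split.
  - by rewrite /upd /= subn0 (input_n inp).
  - by split=> [|e]; rewrite ?unvisited // (blank_weights bl).
  - by apply: blank_indicator; case: bl.
  - by apply: blank_indicator; case: bl.
  - rewrite /upd /= (input_M inp); split=> // [e|]; first by rewrite unvisited.
    by left.
apply: (@hoare_upto _ _ _ descending) => // [j s [[]]|j s lt_j I] //.
have [_ _ ranks _] := rank_topological.
have [e rank_e] := ranks (n - j.+1)%N ltac:(lia).
have ej : narr s 2 (n - j).-1 = e.+1.
  by rewrite -(descending_ranked I e) rank_e subnS.
have pj : narr s 0 e.+1 = parent T e := input_parent (descending_input I) e.
have wj : rarr s 0 e.+1 = w e := input_w (descending_input I) e.
have weightE : rarr s 6 (parent T e) + w e = path_weight T w (head e).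
  rewrite (weights_of_parent lt_j rank_e (descending_weights I)).
  by rewrite -path_weight_head.
have degE : narr s 1 e.+1 = degree T (head e) := descending_degrees I (head e).
have weights := weights_of_visit lt_j rank_e (descending_weights I).
rewrite /= /upd /= (descending_counter I) ej pj wj weightE degE -leaf_degree.
rewrite eqxx (input_M (descending_input I)).
have counterE : (n - j).-1 = (n - j.+1)%N by rewrite subnS.
have badE : (head e \in bad) =
    (head e \in leaves T) && (path_weight T w (head e) < M).
  by rewrite inE.
case: I => inp deg rk _ _ lv bd ls.
have le_M : rreg s 2 <= M by case: ls.
case: (boolP (head e \in leaves T)) badE => [leaf_e|Nleaf_e] /=; last first.
  move=> Nbad; split=> //; first by case: inp => *; split.
  - exact: (indicator_of_skip lt_j rank_e).
  - by apply: (indicator_of_skip lt_j rank_e); rewrite ?Nbad.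
  - by apply: (least_of_skip lt_j rank_e) => // /(negP Nleaf_e).
have lv' := indicator_of_visit lt_j rank_e leaf_e lv.
(* A leaf of weight at least [M] cannot lower the minimum, which is capped at [M]; so the program
   updates it at bad leaves only. *)
case: (ltP _ M) => [lt_M|ge_M] badE; last first.
  split=> //; first by case: inp => *; split.
  - by apply: (indicator_of_skip lt_j rank_e); rewrite ?badE.
  - by apply: (least_of_skip lt_j rank_e) => // _; apply: le_trans ge_M.
have bd' := indicator_of_visit lt_j rank_e badE bd.
case: ltP => [lt_D|ge_D]; split=> //; try by case: inp => *; split.
- exact: (least_of_visit lt_j rank_e leaf_e lt_D ls).
- exact: (least_of_skip lt_j rank_e _ ls).
Qed.

Lemma descending_least_weight s :
  descending n s -> least_weight T w M (rreg s 2).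
Proof.
case=> _ _ _ _ _ _ _ [le_M le_D D_eq]; split=> // t leaf_t.
have [t0|[e te]] := nodeP t.
  by case/negP: (root_not_leaf T n_gt0); rewrite -t0.
by rewrite te; apply: le_D; rewrite ?/visited ?subnn -?te.
Qed.

Lemma descending_indicator A f : A \subset leaves T -> indicator_of A n f ->
  forall v, f v = (v \in A)%:R.
Proof.
move=> /subsetP leafA [f0 fE] v; have [->|[e ->]] := nodeP v; last first.
  by rewrite [LHS]fE /visited subnn.
rewrite [LHS]f0; case: (boolP (_ \in A)) => // /leafA.
by rewrite (negPf (root_not_leaf T n_gt0)).
Qed.

(** * Leaf counts, forwards along the queue *)

Definition summed A j f : Prop := forall v, f v =
  ((v \in A) + \sum_(e | (rank e < j)%N && (parent T e == v))
     count_below T A (head e))%N%:R.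

Record summing_up j s : Prop := SummingUp {
  summing_up_input : has_input j s;
  summing_up_ranked : ranked s;
  summing_up_least : least_weight T w M (rreg s 2);
  summing_up_leaves : summed (leaves T) j (rarr s 4);
  summing_up_bad : summed bad j (rarr s 5)
}.

(** All child edges of [head e] have rank below [j], so its entry is already the full count and can
    be passed on to the parent. *)
Lemma summed_step A j e f : rank e = j -> summed A j f ->
  summed A j.+1 (upd f (parent T e) (f (parent T e) + f e.+1)).
Proof.
move=> rank_e fE v.
have [_ rank_inj _ order] := rank_topological.
have fe : f e.+1 = (count_below T A (head e))%:R.
  rewrite (fE (head e)) count_below_children; congr (_ + _)%N%:R.
  apply: eq_bigl => x; rewrite andb_idl // => /eqP/order.
  by rewrite rank_e.
have stepE x : (rank x < j.+1)%N = (x == e) || (rank x < j)%N.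
  by rewrite ltnS leq_eqVlt -rank_e (inj_eq rank_inj).
have [pv|pNv] := eqVneq (parent T e) v.
  rewrite /upd pv eqxx fE fe -natrD -addnA; congr (_ + _)%N%:R.
  rewrite [RHS](bigD1 e) /=; last by rewrite stepE eqxx pv eqxx.
  rewrite addnC; congr addn; apply: eq_bigl => x; rewrite stepE.
  by case: (x =P e) => [->|_] /=; rewrite ?rank_e ?ltnn ?andbF ?andbT.
rewrite /upd val_eqE eq_sym (negPf pNv) fE; congr (_ + _)%N%:R.
apply: eq_bigl => x; rewrite stepE; case: (x =P e) => [->|_] //=.
by rewrite (negPf pNv) andbF.
Qed.

Lemma sum_up_correct : hoare n (descending n) sum_up (summing_up n).
Proof.
apply: (@hoare_upto _ _ _ summing_up) => // [j s [[]] //|s I|j s lt_j I].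
  split; first by case: (descending_input I) => *; split.
  - exact: descending_ranked I.
  - exact: (descending_least_weight I).
  - move=> v; rewrite big_pred0 ?addn0 => [|//].
    apply: (descending_indicator _ (descending_leaves I)).
    exact: subxx.
  - move=> v; rewrite big_pred0 ?addn0 => [|//].
    apply: (descending_indicator _ (descending_bad I)).
    by apply/subsetP => t; rewrite inE => /andP[].
have [_ _ ranks _] := rank_topological; have [e rank_e] := ranks j lt_j.
have ej : narr s 2 j = e.+1 by rewrite -rank_e (summing_up_ranked I).
have pj : narr s 0 e.+1 = parent T e := input_parent (summing_up_input I) e.
rewrite /= /upd /= ej pj.
case: I => inp rk ls lv bd; split=> //; first by case: inp => *; split.
- exact: summed_step.
- exact: summed_step.
Qed.

(** * Choice of the best candidate *)

Local Notation cand := (candidate T w u c K M).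
Local Notation gain_of := (gain T w u c K).
Local Notation raise_of := (max_raise w u c K).

Definition best_of j s : Prop :=
  [/\ nreg s 1 = 0%N, rreg s 3 = - 1
    & forall e : 'I_n, (e < j)%N -> ~~ cand (rreg s 2) e] \/
  exists e, [/\ nreg s 1 = 1%N, nreg s 5 = e.+1 /\ rreg s 4 = raise_of e,
    rreg s 3 = gain_of e, cand (rreg s 2) e
    & forall x : 'I_n, (x < j)%N -> cand (rreg s 2) x ->
        gain_of x <= gain_of e].

(* The loop counter and the number of copied weights are one step ahead of the
   best edge between [compute_raise] and [keep_best]. *)
Record selecting i j s : Prop := Selecting {
  selecting_input : has_input i s;
  selecting_least : least_weight T w M (rreg s 2);
  selecting_leaves :
    forall e, rarr s 4 e.+1 = (count_below T (leaves T) (head e))%:R;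
  selecting_bad : forall v, rarr s 5 v = (count_below T bad v)%:R;
  selecting_copy : forall e : 'I_n, (e < i)%N -> rarr s 3 e.+1 = w e;
  selecting_best : best_of j s
}.

Lemma keep_best_correct e s : selecting e.+1 e s -> rreg s 5 = raise_of e ->
  selecting e.+1 e.+1 (run keep_best s).
Proof.
case=> inp ls lv bd cp best raiseE.
have candE : (rarr s 5 e.+1 == rarr s 5 0%N) &&
    ~~ (rreg s 2 + rreg s 5 < rreg s 1) = cand (rreg s 2) e.
  rewrite (bd (head e)) (bd ord0) raiseE (input_M inp) eqr_nat -leNgt.
  by [].
have gainE : rarr s 4 e.+1 * rreg s 5 = gain_of e by rewrite lv raiseE.
have ltS (x : 'I_n) : (x < e.+1)%N = (x == e) || (x < e)%N.
  by rewrite ltnS leq_eqVlt.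
rewrite /= (input_counter inp) /upd /= candE gainE.
case: ifP => [/andP[cand_e gt_e]|/negbT no].
  split=> //; first by case: inp => *; split.
  right; exists e; split=> //.
  - by split; [exact: (input_counter inp) | exact: raiseE].
  - by rewrite /= /upd /= (input_counter inp).
  move=> x; rewrite ltS => /predU1P[->|lt_x cand_x] //=.
  apply: le_trans (ltW gt_e).
  case: best => [[_ _ none]|[y [_ _ -> _ best]]]; last exact: best.
  by have := none x lt_x; rewrite cand_x.
split=> //; case: best => [[st gain0 none]|[y [st yE gain_y cand_y best]]].
  left; split=> // x; rewrite ltS => /predU1P[->|/none //].
  apply: contra no => cand_e; rewrite cand_e /= gain0.
  (* From [D <= M <= D + raise_of e]. Hence the gain of a candidate exceeds the initial value -1,
     and a first candidate is never rejected, even with gain 0. *)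
  have raise_ge0 : 0 <= raise_of e.
    by case/andP: cand_e => _; case: ls; move: (raise_of e) => d; lra.
  by rewrite (lt_le_trans (ltrN10 R)) // mulr_ge0.
right; exists y; split=> // x; rewrite ltS => /predU1P[->|lt_x] cand_x.
  by rewrite -gain_y leNgt; apply: contra no; rewrite cand_x.
exact: best.
Qed.

Lemma select_correct : hoare n (summing_up n)
  (Seq (Seq (NSet 1 (NConst 0)) (RSet 3 (RSub RZero ROne))) select)
  (fun s => selecting n n s).
Proof.
apply: (@hoare_seq _ _ _ (fun s => selecting 0 0 (set_nreg s 2 0))).
  apply: hoare_straight => // s [inp _ ls lv bd].
  have [lt_n _ _ _] := rank_topological.
  (* After all [n] rounds the sum runs over all children, and the recursion gives the full
     counts. *)
  have sums A f : summed A n f -> forall v, f v = (count_below T A v)%:R.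
    move=> fE v; rewrite fE count_below_children; congr (_ + _)%N%:R.
    by apply: eq_bigl => e; rewrite lt_n.
  split=> //; first by case: inp => *; split.
  - by move=> e; apply: (sums _ _ lv (head e)).
  - exact: sums bd.
  - by left; split=> //; rewrite /= /upd /= sub0r.
apply: (@hoare_upto _ _ _ (fun j => selecting j j)) => // [j s [[]] //|].
move=> j s lt_j.
rewrite -[j]/(Ordinal lt_j : nat); move: (Ordinal lt_j) => e {j lt_j} I.
rewrite -[run _ _]/(run keep_best (run (Seq (RPut 3 (NReg 2) (RGet 0 (NReg 2)))
  compute_raise) (set_nreg s 2 e.+1))).
apply: keep_best_correct; last first.
  have inp := selecting_input I; rewrite /= /upd /= (input_K inp).
  rewrite (input_c inp) (input_u inp) (input_w inp) /max_raise.
  by case: ltP.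
case: I => inp ls lv bd cp best.
have copied (x : 'I_n) : (x < e.+1)%N ->
    upd (rarr s 3) e.+1 (rarr s 0 e.+1) x.+1 = w x.
  rewrite /upd eqSS ltnS leq_eqVlt val_eqE.
  by case: eqP => [-> _|_ /= /cp //]; rewrite (input_w inp).
by rewrite /=; case: ifP => _; split=> //; case: inp => *; split.
Qed.

(** If a candidate was found, [candidate_optimal] applies; otherwise [feasible_raise] would extract
    a candidate from any feasible vector. *)
Lemma output_correct s : selecting n n s ->
  correct_output T w u c K M
    (run (RPut 3 (NReg 5) (RAdd (RGet 3 (NReg 5)) (RReg 4))) s).
Proof.
case=> inp ls _ _ cp best; have w_le_u e : w e <= u e by case/andP: (wu e).
case: best => [[st _ none]|[e [st [eE raiseE] _ cand_e best]]]; last first.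
  left; split=> //.
  apply: (candidate_optimal n_gt0 w_le_u c_gt0 ls cand_e) => [x|x].
    exact: best.
  rewrite /solution /raise /= /upd /= eE eqSS val_eqE raiseE.
  by case: eqP => [->|_]; rewrite ?addr0 cp.
right; split=> // w' /(feasible_raise n_gt0 c_gt0 ls)[e [d [_ cand_e _]]].
by have := none e (ltn_ord e); rewrite cand_e.
Qed.

Lemma optimizing_correct :
  hoare n (fun s => [/\ has_input n s, blank s, degrees s & ranked s])
    optimizing (correct_output T w u c K M).
Proof.
apply: hoare_seq descend_correct _; apply: (hoare_seq sum_up_correct).
apply: hoare_seq select_correct _; apply: hoare_straight => // s.
exact: output_correct.
Qed.

End Ranked.

Lemma sorting_correct : hoare n (eq (input T w u c K M)) sorting (peeling n).
Proof.
apply: (hoare_seq count_children_correct).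
exact: (hoare_seq push_leaves_correct peel_correct).
Qed.

Lemma program_correct : hoare n (eq (input T w u c K M))
  (Seq sorting optimizing) (correct_output T w u c K M).
Proof.
apply: (hoare_seq sorting_correct) => s.
case/peeling_topological => rank topo sorted_s.
exact: (optimizing_correct topo).
Qed.

End Correctness.

Theorem theorem7 :
  exists (P : cmd) (C : nat),
    forall (R : realFieldType) (n : nat) (T : rtree n)
           (w u c : 'I_n -> R) (K M : R),
      (0 < n)%N ->
      (forall e : 'I_n, 0 <= w e <= u e) ->
      (forall e : 'I_n, 0 < c e) ->
      exists (t : nat) (s : state R),
        [/\ exec P (input T w u c K M) t s,
            (t <= C * n)%N
          & correct_output T w u c K M s].
Proof.
(* The factor 2 absorbs [n.+1 <= 2 * n], valid as [n > 0]. *)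
exists (Seq sorting optimizing), (cost (Seq sorting optimizing) * 2)%N.
move=> R n T w u c K M n_gt0 wu c_gt0.
have [t [s [E le_t out]]] :=
  @program_correct R n T w u c K M n_gt0 wu c_gt0 _ erefl.
exists t, s; split=> //; move: (cost _) le_t => k /leq_trans; apply.
by rewrite -mulnA leq_mul2l mul2n -addnn -addn1 leq_add2l n_gt0 orbT.
Qed.
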